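(* Let $H$ be a real Hilbert space and $\Psi=F+R$, where $R:H\to\mathbb{R}\cup\{\pm\infty\}$ is proper, convex and lower semicontinuous, and $F:H\to\mathbb{R}$ is continuously Fréchet differentiable on $\operatorname{int}(\operatorname{dom}F)\supseteq\operatorname{dom}R$. Consider the nonmonotone splitting algorithm described in the context. Then for every $k\ge0$ the following statements hold. (i) For $\delta\in(0,\frac12)$, the nonmonotone linesearch is well-defined. That is, there exists $\underline{\alpha}>0$ such that for every $u_k\in\operatorname{int}(\operatorname{dom}F)$ and every $\alpha_k\in[\underline\alpha,\infty)$ the nonmonotone rule $$\Psi(u_{k+1})\le\max_{0\le j\le m(k)}\Psi(u_{k-j})-\frac{\delta}{\alpha_k}\|G_{\alpha_k}(u_k)\|^2,\qquad u_{k+1}=T_{\alpha_k}(u_k),\qquad(\ast)$$ holds, and thus the nonmonotone linesearch terminates after finitely many iterations. Assume in addition that $\nabla F:H\to H$ is globally $L$-Lipschitz continuous with $L>0$. Then: (ii) The statement of (i) is true for $\underline\alpha:=\frac{L}{2(1-\delta)}$ and every fixed $\delta\in(0,1)$. (iii) The step-sizes are uniformly bounded from above. That is, for every $k\ge1$, $\alpha_k\le\bar\alpha$ with $\bar\alpha:=\max\{\frac{\eta L}{2(1-\delta)},\alpha_{\sup}\}$. (iv) It holds $\|G_{\alpha_{k+1}}(u_{k+1})\|\le C_G\|G_{\alpha_k}(u_k)\|$, where $C_G:=\frac{3\bar\alpha+L}{\alpha_{\inf}}$.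
   Context: The scalar product and norm of $H$ are $(\cdot,\cdot)$ and $\|\cdot\|$. For $u\in\operatorname{int}(\operatorname{dom}F)$, $\nabla F(u)\in H$ is the Riesz representative of the derivative $F'(u)$. For $\alpha>0$: $\operatorname{Prox}_{\frac1\alpha R}(u):=\operatorname{argmin}_{v\in H}\big(R(v)+\frac{\alpha}{2}\|v-u\|^2\big)$, $T_\alpha(u):=\operatorname{Prox}_{\frac1\alpha R}\big(u-\frac1\alpha\nabla F(u)\big)$ (prox-grad operator), and $G_\alpha(u):=\alpha(u-T_\alpha(u))$ (gradient mapping). Nonmonotone splitting algorithm. Parameters: $0<\delta<1$, $m_{\max}\in\mathbb{N}_0$, $\eta>1$, $\alpha_{\sup}>\alpha_{\inf}>0$, $u_0\in H$, $\alpha_0>0$. Memory: $m(0)=0$, $m(k)=\min\{m(k-1)+1,m_{\max}\}$ for $k\ge1$. Starting from $k=0$, as long as the gradient mapping at $u_k$ is nonzero (whether $G_\alpha(u_k)=0$ does not depend on $\alpha>0$): compute a Barzilai–Borwein value $\alpha_k^{BB}$, set $\alpha_{\mathrm{int},k}:=\max\{\alpha_{\inf},\min\{\alpha_{\sup},\alpha_k^{BB}\}\}$ and $\alpha_k:=\alpha_{\mathrm{int},k}\,\eta^{i_k}$, where $i_k\in\mathbb{N}_0$ is the smallest integer for which, with $u_{k+1}:=T_{\alpha_k}(u_k)=u_k-\frac{1}{\alpha_k}G_{\alpha_k}(u_k)$, $$\Psi(u_{k+1})\le\max_{0\le j\le m(k)}\Psi(u_{k-j})-\frac{\delta}{\alpha_k}\|G_{\alpha_k}(u_k)\|^2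 ;$$ then pass to $u_{k+1}$ and replace $k$ by $k+1$. The search for $i_k$ is the nonmonotone linesearch, and the displayed inequality is the nonmonotone rule. Barzilai–Borwein values: $\alpha_0^{BB}:=\alpha_0$; for $k\ge1$, with $s=u_k-u_{k-1}$, $y=\nabla F(u_k)-\nabla F(u_{k-1})$, $z=G_{\alpha_{k-1}}(u_k)-G_{\alpha_{k-1}}(u_{k-1})$, the value $\alpha_k^{BB}$ is one of $\frac{(s,y)}{(s,s)},\ \frac{(y,y)}{(s,y)},\ \frac{(s,z)}{(s,s)},\ \frac{(z,z)}{(s,z)}$, or alternates between the first two, or between the last two (first of the pair for even $k$, second for odd $k$); if a denominator is zero any real value may be used. In (iii) and (iv), $u_k,\alpha_k$ (and $u_{k+1},\alpha_{k+1}$) are quantities generated by the algorithm.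
   Formalization: In (i) the threshold $\underline\alpha$ may depend on the point $u_k$ (not on $k$ or earlier iterates); a threshold uniform over all $u_k\in\operatorname{int}(\operatorname{dom}F)$ fails, e.g. for $H=\mathbb{R}$, $R=0$, $F(x)=x^4$. *)

(* Defs.v *)
From HB Require Import structures.
From mathcomp Require Export all_boot all_order all_algebra.
From mathcomp Require Export sesquilinear.
From mathcomp Require Export all_classical all_reals all_analysis.
Set Implicit Arguments.
Unset Strict Implicit.
Unset Printing Implicit Defensive.
Import Order.TTheory GRing.Theory Num.Theory.
Import numFieldNormedType.Exports.
Local Open Scope classical_set_scope.
Local Open Scope ring_scope.
Local Open Scope ereal_scope.

Section ExtendedRealFunctionals.
Context {R : realType} {H : completeNormedModType R}.

(* A complete normed module whose norm is induced by the scalar product dot is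
   a real Hilbert space. *)
Definition induces_norm (dot : {dot H for idfun}) : Prop :=
  forall u : H, dot u u = (`|u| ^+ 2)%R.

Definition edom (f : H -> \bar R) : set H := [set u | f u < +oo].

Definition proper_fun (f : H -> \bar R) : Prop :=
  edom f !=set0 /\ forall u, -oo < f u.

Definition econvex_fun (f : H -> \bar R) : Prop :=
  forall (u v : H) (t : R), (0 < t < 1)%R ->
    f (t *: u + (1 - t) *: v)%R <= t%:E * f u + (1 - t)%:E * f v.

(* Points where f is finite-valued are the only ones at which this function is
   meaningful; 'd (real_part f) u below is only used for u interior to
   edom f. *)
Definition real_part (f : H -> \bar R) : H -> R := fine \o f.

(* Continuity of the derivative is continuity for the dual (operator) norm. *)
Definition continuously_differentiable (f : H -> \bar R) (A : set H) : Prop :=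
  forall u, A u ->
    differentiable (real_part f) u /\
    forall e : R, (0 < e)%R -> \forall v \near u, forall h : H,
      (`|'d (real_part f) v h - 'd (real_part f) u h| <= e * `|h|)%R.

(* The Riesz representative of the derivative, meaningful where real_part F is
   differentiable. *)
Definition gradient (dot : {dot H for idfun}) (F : H -> \bar R) (u : H) : H :=
  get [set g | forall h, 'd (real_part F) u h = dot g h].

Definition argmin (f : H -> \bar R) : H :=
  get [set v | forall w, f v <= f w].

(* prox a Reg is the proximal operator of (1 / a) Reg. *)
Definition prox (a : R) (Reg : H -> \bar R) (u : H) : H :=
  argmin (fun v => Reg v + (a / 2 * `|v - u| ^+ 2)%:E).

End ExtendedRealFunctionals.

Section NonmonotoneSplitting.
Context {R : realType} {H : completeNormedModType R}.
Variables (dot : {dot H for idfun}) (F Reg : H -> \bar R).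

Definition objective (u : H) : \bar R := F u + Reg u.

Definition prox_grad (a : R) (u : H) : H :=
  prox a Reg (u - a^-1 *: gradient dot F u)%R.

Definition gradient_mapping (a : R) (u : H) : H := (a *: (u - prox_grad a u))%R.

Fixpoint memory (mmax k : nat) : nat :=
  if k is k'.+1 then minn (memory mmax k').+1 mmax else 0.

(* The nonmonotone rule at iteration k for the trial step-size a. Only
   u 0, ..., u k matter: as memory mmax k <= k, the subtraction k - j is
   never truncated. *)
Definition nonmonotone_rule (delta : R) (mmax : nat) (u : nat -> H) (k : nat)
    (a : R) : Prop :=
  objective (prox_grad a (u k)) <=
    (\big[maxe/-oo]_(j < (memory mmax k).+1) objective (u (k - j)%N))
    - (delta / a * `|gradient_mapping a (u k)| ^+ 2)%:E.

Definition initial_step (ainf asup aBB : R) : R :=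
  Num.max ainf (Num.min asup aBB).

Definition linesearch_index (delta : R) (mmax : nat) (eta : R) (u : nat -> H)
    (k : nat) (aint : R) (i : nat) : Prop :=
  nonmonotone_rule delta mmax u k (aint * eta ^+ i) /\
  forall i', nonmonotone_rule delta mmax u k (aint * eta ^+ i') -> (i <= i')%N.

(* The second clause says that the linesearch terminates; it is required for
   every real aBB, hence for every possible Barzilai-Borwein value. *)
Definition linesearch_well_defined (delta : R) (mmax : nat)
    (eta ainf asup : R) (u : nat -> H) (k : nat) (alow : R) : Prop :=
  (forall a : R, (alow <= a)%R -> nonmonotone_rule delta mmax u k a) /\
  (forall aBB : R, exists i,
     linesearch_index delta mmax eta u k (initial_step ainf asup aBB) i).

(* Pairs (numerator, denominator) for consecutive iterates u, v, where a is the
   step-size that produced v from u. *)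
Definition BB_quotients (u v : H) (a : R) : seq (R * R) :=
  let s := (v - u)%R in
  let y := (gradient dot F v - gradient dot F u)%R in
  let z := (gradient_mapping a v - gradient_mapping a u)%R in
  [:: (dot s y, dot s s); (dot y y, dot s y);
      (dot s z, dot s s); (dot z z, dot s z)].

(* The quotient may be chosen anew at each iteration; using one fixed quotient
   and alternating between two of them according to the parity of k are special
   cases. If the denominator is zero, any value is admissible. *)
Definition BB_value (a0 : R) (u : nat -> H) (alpha : nat -> R) (k : nat)
    (aBB : R) : Prop :=
  if k is k'.+1 then
    exists2 q, q \in BB_quotients (u k') (u k) (alpha k') &
      (q.2 != 0 -> aBB = q.1 / q.2)%R
  else aBB = a0.

(* u and alpha agree with a run of the algorithm that performs (at least) the
   iterations 0, ..., n - 1; these generate u 0, ..., u n and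
   alpha 0, ..., alpha (n - 1). The parameter a0 is the initial
   Barzilai-Borwein value, not the accepted step-size alpha 0. *)
Definition splitting_run (delta : R) (mmax : nat) (eta ainf asup : R) (u0 : H)
    (a0 : R) (n : nat) (u : nat -> H) (alpha : nat -> R) : Prop :=
  u 0%N = u0 /\
  forall k, (k < n)%N ->
    exists aBB i,
      [/\ BB_value a0 u alpha k aBB,
          linesearch_index delta mmax eta u k (initial_step ainf asup aBB) i,
          alpha k = (initial_step ainf asup aBB * eta ^+ i)%R,
          gradient_mapping (alpha k) (u k) != 0%R &
          u k.+1 = prox_grad (alpha k) (u k)].

End NonmonotoneSplitting.

(* Main.v *)
Require Import Defs.
From mathcomp Require Import ring lra.
Set Implicit Arguments.
Unset Strict Implicit.
Unset Printing Implicit Defensive.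
Import Order.TTheory GRing.Theory Num.Theory.
Import numFieldNormedType.Exports.
Local Open Scope classical_set_scope.
Local Open Scope ring_scope.

(** Write p = T_a(x), g for the gradient of F at x, and s for the norm of
    x - p, so that the gradient mapping has norm a s.

    Everything rests on one variational inequality for the proximal point
    (prox_variational), i.e. on the fact that a (u - prox u) is a subgradient
    of the regularizer at prox u. Testing it at x gives
      Reg(p) + (g, p - x) + a s^2 <= Reg(x)            (prox_grad_decrease),
    so the nonmonotone rule, even with Psi(x) in place of the maximum, holds as
    soon as the linear model of F at x satisfies
      F(p) - F(x) - (g, p - x) <= (1 - delta) a s^2
    (nonmonotone_rule_of_model_error).

    With an L-Lipschitz gradient the left-hand side is at most L s^2 / 2, which
    settles a >= L / (2 (1 - delta)). If F is merely differentiable at x, the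
    left-hand side is only o(s), and the point is that a s, the norm of the
    gradient mapping, does not decrease when a grows
    (gradient_mapping_nondecreasing): either the gradient mapping vanishes and
    p = x, or a s stays above a constant c > 0, so that o(s), once below
    (1 - delta) c s, is below (1 - delta) a s^2. That s tends to 0 as a grows
    follows from the decrease inequality, because a proper convex lower
    semicontinuous function has an affine minorant (prox_grad_near).

    The linesearch thus accepts every step-size above a threshold; the accepted
    one is either the initial one, at most asup, or exceeds a rejected one by
    the factor eta (step_size_le). Finally, adding the variational inequalities
    at v = T_a(x) and at T_b(v), each tested at the other point, bounds the
    norm of G_b(v) by (a + L) times the norm of x - v, independently of b
    (gradient_mapping_next).

    Existence of proximal points is proved by the direct method: minimizing
    sequences are Cauchy by strong convexity. The Riesz theorem, which gives
    meaning to the gradient, is the special case of a linear regularizer. *)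

(** * Inner product *)

Section InnerProduct.
Context {R : realType} {H : completeNormedModType R}.
Variable dot : {dot H for idfun}.
Hypothesis hdot : induces_norm dot.
Implicit Types u v w : H.

Lemma dotC u v : dot u v = dot v u.
Proof. by rewrite hermitian_subproof expr0 mul1r. Qed.

Lemma dotDr u v w : dot u (v + w) = dot u v + dot u w.
Proof. exact: raddfD. Qed.

Lemma dotNr u v : dot u (- v) = - dot u v.
Proof. exact: raddfN. Qed.

Lemma dotZr (t : R) u v : dot u (t *: v) = t * dot u v.
Proof. exact: linearZ. Qed.

Lemma dotDl u v w : dot (u + v) w = dot u w + dot v w.
Proof. by rewrite ![dot _ w]dotC dotDr. Qed.

Lemma dotNl u v : dot (- u) v = - dot u v.
Proof. by rewrite ![dot _ v]dotC dotNr. Qed.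

Lemma dotZl (t : R) u v : dot (t *: u) v = t * dot u v.
Proof. by rewrite ![dot _ v]dotC dotZr. Qed.

Definition dotE := (dotDl, dotDr, dotNl, dotNr, dotZl, dotZr).

Lemma normsqD u v : `|u + v| ^+ 2 = `|u| ^+ 2 + 2 * dot u v + `|v| ^+ 2.
Proof. by rewrite -!hdot !dotE (dotC v u); ring. Qed.

Lemma cauchy_schwarz u v : dot u v <= `|u| * `|v|.
Proof.
have [->|u0] := eqVneq u 0.
  by rewrite dotC -(scale0r u) dotZr mul0r mulr_ge0.
have [->|v0] := eqVneq v 0.
  by rewrite -(scale0r v) dotZr mul0r mulr_ge0.
have uv_gt0 : 0 < `|u| * `|v| by rewrite mulr_gt0 ?normr_gt0.
(* Expanding the square of this norm leaves 2 |u| |v| (|u| |v| - (u, v)). *)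
have := sqr_ge0 `| `|v| *: u + (- `|u|) *: v|.
rewrite normsqD !normrZ dotZl dotZr !normrN !normr_id => ge0.
have {}ge0 : 0 <= `|u| * `|v| * (`|u| * `|v| - dot u v) by lra.
by rewrite -subr_ge0 -(pmulr_rge0 _ uv_gt0).
Qed.

End InnerProduct.

(** Lets a direction of variation shrink: the quadratic term in t is absorbed
    after division by t. *)
Lemma le0_of_le_small {R : realFieldType} (x y : R) :
  (forall t, 0 < t < 1 -> x <= t * y) -> x <= 0.
Proof.
move=> le_xty; rewrite leNgt; apply/negP => x_gt0.
have s_gt0 : 0 < 2 * (x + `|y|) by rewrite mulr_gt0// ltr_wpDr.
have t01 : 0 < x / (2 * (x + `|y|)) < 1.
  rewrite divr_gt0//= ltr_pdivrMr// mul1r.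
  by have := normr_ge0 y; lra.
have := le_xty _ t01; rewrite -mulrA (mulrC _ y) mulrA ler_pdivlMr//.
have := ler_norm y; have := normr_ge0 y; move: x_gt0; clear.
set n := `|y| => x_gt0 n0 yn; nra.
Qed.

(** * Convex functionals and proximal points *)

Lemma edom_EFin {R : realType} {H : completeNormedModType R} (f : H -> \bar R)
    (f_gtNy : forall u, (-oo < f u)%E) u :
  edom f u -> f u = (real_part f u)%:E.
Proof. by move=> fu; rewrite fineK// fin_numElt f_gtNy fu. Qed.

Section Convex.
Context {R : realType} {H : completeNormedModType R}.
Variable Reg : H -> \bar R.
Hypotheses (Reg_proper : proper_fun Reg) (Reg_convex : econvex_fun Reg)
  (Reg_lsc : lower_semicontinuous Reg).
Local Notation r := (real_part Reg).

Let Reg_gtNy : forall u, (-oo < Reg u)%E := Reg_proper.2.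

Lemma real_part_convex u v (t : R) : edom Reg u -> edom Reg v -> 0 < t < 1 ->
  edom Reg (v + t *: (u - v)) /\
  r (v + t *: (u - v)) <= r v + t * (r u - r v).
Proof.
move=> du dv t01; have := Reg_convex u v t01.
have -> : t *: u + (1 - t) *: v = v + t *: (u - v).
  by rewrite scalerBl scale1r scalerBr addrCA.
rewrite (edom_EFin Reg_gtNy du) (edom_EFin Reg_gtNy dv) -!EFinM -EFinD.
move=> le_conv.
have dw : edom Reg (v + t *: (u - v)).
  exact: le_lt_trans le_conv (ltry _).
by split=> //; move: le_conv; rewrite (edom_EFin Reg_gtNy dw) lee_fin; lra.
Qed.

(** Lower semicontinuity bounds the function from below on a small ball around a
    point x0 of its domain; a point farther away is compared with the point of the
    segment to x0 at distance p from x0, and convexity turns the drop by at most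
    1 on the ball into a linear bound. *)
Lemma affine_minorant : exists c b : R, 0 <= b /\
  forall v, edom Reg v -> c - b * `|v| <= r v.
Proof.
have [x0 dx0] := Reg_proper.1.
have [V V0 Vgt] : exists2 V, nbhs x0 V &
    forall y, V y -> ((r x0 - 1)%:E < Reg y)%E.
  by apply: Reg_lsc; rewrite (edom_EFin Reg_gtNy dx0) lte_fin; lra.
have [/= e /= e_gt0 eV] := (nbhs_ballP _ _).1 V0.
have [p p_gt0 p_lt_e] : exists2 p : R, 0 < p & p < e.
  by exists (e / 2); lra.
have pV_ge0 : 0 <= p^-1 by rewrite invr_ge0 ltW.
exists (r x0 - 1 - p^-1 * `|x0|), p^-1; split=> // v dv.
have : r x0 - 1 - p^-1 * `|v - x0| <= r v.
  have [near_x0|far] := leP `|v - x0| p.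
    have : ((r x0 - 1)%:E < Reg v)%E.
      by apply/Vgt/eV; rewrite -ball_normE /= distrC; exact: le_lt_trans p_lt_e.
    rewrite (edom_EFin Reg_gtNy dv) lte_fin => lt_rv.
    by have := mulr_ge0 pV_ge0 (normr_ge0 (v - x0)); lra.
  have d_gt0 : 0 < `|v - x0| by exact: lt_trans far.
  have t01 : 0 < p / `|v - x0| < 1.
    by rewrite divr_gt0//= ltr_pdivrMr// mul1r.
  have [dw le_rw] := real_part_convex dv dx0 t01.
  have : ((r x0 - 1)%:E < Reg (x0 + (p / `|v - x0|) *: (v - x0))%R)%E.
    apply/Vgt/eV; rewrite -ball_normE /= opprD addrA subrr add0r normrN normrZ.
    by rewrite gtr0_norm ?(andP t01).1// divfK// gt_eqF.
  rewrite (edom_EFin Reg_gtNy dw) lte_fin => /lt_le_trans/(_ le_rw).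
  rewrite -subr_gt0.
  have -> : r x0 + p / `|v - x0| * (r v - r x0) - (r x0 - 1) =
      (p / `|v - x0|) * (r v - (r x0 - p^-1 * `|v - x0|)).
    by field; rewrite !gt_eqF.
  by rewrite pmulr_rgt0 ?(andP t01).1//; lra.
have : p^-1 * `|v - x0| <= p^-1 * (`|v| + `|x0|).
  by rewrite ler_wpM2l// ler_normB.
by rewrite mulrDr; lra.
Qed.

Section Prox.
Variable dot : {dot H for idfun}.
Hypothesis hdot : induces_norm dot.
Variable a : R.
Hypothesis a_gt0 : 0 < a.

Let phi (u v : H) : R := r v + a / 2 * `|v - u| ^+ 2.

(** The quadratic term dominates the affine minorant. *)
Lemma phi_lbound u : exists m, forall v, edom Reg v -> m <= phi u v.
Proof.
have [c [b [b_ge0 minor]]] := affine_minorant.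
exists (c - b * `|u| - b ^+ 2 / (2 * a)) => v /minor le_rv.
have : b * `|v| <= b * (`|v - u| + `|u|).
  by rewrite ler_wpM2l// -[X in `|X| <= _](subrK u v) ler_normD.
have : 0 <= a / 2 * (`|v - u| - b / a) ^+ 2.
  by rewrite mulr_ge0 ?sqr_ge0// divr_ge0// ltW.
have -> : a / 2 * (`|v - u| - b / a) ^+ 2 =
    a / 2 * `|v - u| ^+ 2 - b * `|v - u| + b ^+ 2 / (2 * a).
  by field; rewrite gt_eqF.
by rewrite /phi; lra.
Qed.

(** Strong convexity at the midpoint: near-minimizers are close together. *)
Lemma phi_midpoint u v w (m : R) : edom Reg v -> edom Reg w ->
  (forall z, edom Reg z -> m <= phi u z) ->
  m + a / 8 * `|v - w| ^+ 2 <= (phi u v + phi u w) / 2.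
Proof.
move=> dv dw lbm.
have half01 : 0 < (2^-1 : R) < 1 by rewrite invr_gt0//= invf_lt1//; lra.
have [dz le_rz] := real_part_convex dv dw half01.
have := lbm _ dz; rewrite /phi addrAC.
have vE : v - u = (w - u) + (v - w) by rewrite [RHS]addrC subrKA.
rewrite [in X in _ -> _ <= X]vE !(normsqD hdot (w - u)) normrZ exprMn dotZr.
rewrite (ger0_norm (ltW (andP half01).1)).
by lra.
Qed.

Lemma prox_exists u : exists p, edom Reg p /\
  forall v, edom Reg v -> phi u p <= phi u v.
Proof.
have [m0 m0P] := phi_lbound u.
pose E := phi u @` edom Reg.
have infE : has_inf E.
  have [x0 dx0] := Reg_proper.1.
  split; first by exists (phi u x0); exists x0.
  by exists m0 => _ [v dv <-]; exact: m0P.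
have infP v : edom Reg v -> inf E <= phi u v.
  by move=> dv; apply: ge_inf; [exact: infE.2|exists v].
have /choice[v vP] : forall n : nat, exists v,
    edom Reg v /\ phi u v < inf E + n.+1%:R^-1.
  move=> n.
  have eps_gt0 : 0 < (n.+1%:R^-1 : R) by rewrite invr_gt0 ltr0n.
  have [_ [v dv <-] lt_v] := inf_adherent eps_gt0 infE.
  by exists v.
have vC N n : (N <= n)%N -> `|v N - v n| ^+ 2 <= 8 / a * N.+1%:R^-1.
  move=> Nn; have := phi_midpoint (vP N).1 (vP n).1 infP.
  have := (vP N).2; have := (vP n).2.
  have : n.+1%:R^-1 <= N.+1%:R^-1 :> R by rewrite lef_pV2 ?posrE// ler_nat.
  move: (n.+1%:R^-1) (N.+1%:R^-1) => /= en eN le_e phi_n phi_N mid.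
  have : a / 8 * `|v N - v n| ^+ 2 <= eN by lra.
  by rewrite -ler_pdivlMl ?divr_gt0// invf_div.
have /cauchy_cvg/cvg_ex[p vp] : cauchy (v @ \oo).
  apply: cauchy_exP => e e_gt0.
  have bd_gt0 : 0 < e ^+ 2 / (8 / a) by rewrite !divr_gt0// exprn_gt0.
  have [N Ne] : exists N : nat, 8 / a * N.+1%:R^-1 < e ^+ 2.
    near \oo => N; exists N; rewrite mulrC -ltr_pdivlMr ?divr_gt0//.
    by near: N; exact: near_infty_natSinv_lt (PosNum bd_gt0).
  exists (v N), N => // n /= Nn; rewrite -ball_normE /=.
  have := le_lt_trans (vC _ _ Nn) Ne.
  by rewrite ltr_pXn2r// nnegrE// ltW.
have Reg_p : (Reg p <= (inf E - a / 2 * `|p - u| ^+ 2)%:E)%E.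
  rewrite leNgt; apply/negP => lt_p.
  have [c lt_c c_lt] : exists2 c : R, inf E - a / 2 * `|p - u| ^+ 2 < c &
      (c%:E < Reg p)%E.
    case: (Reg p) lt_p => [x| |//]; rewrite ?lte_fin => lt_x.
      exists (((inf E - a / 2 * `|p - u| ^+ 2) + x) / 2); rewrite ?lte_fin; lra.
    by exists (inf E - a / 2 * `|p - u| ^+ 2 + 1); [lra|exact: ltry].
  have [V Vp Vgt] := Reg_lsc c_lt.
  have cvg_bd : inf E + n.+1%:R^-1 - a / 2 * `|v n - u| ^+ 2 @[n --> \oo] -->
      inf E + 0 - a / 2 * `|p - u| ^+ 2.
    apply: cvgB; first by apply: cvgD; [exact: cvg_cst|exact: cvg_harmonic].
    apply: cvgM; first exact: cvg_cst.
    rewrite expr2; under eq_fun do rewrite expr2.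
    by apply: cvgM; apply: cvg_norm; apply: cvgB => //; exact: cvg_cst.
  rewrite addr0 in cvg_bd.
  near \oo => n.
  have bd_lt : inf E + n.+1%:R^-1 - a / 2 * `|v n - u| ^+ 2 < c.
    by near: n; exact: cvgr_lt cvg_bd _ lt_c.
  have : (c%:E < Reg (v n))%E by apply: Vgt; near: n; exact: vp.
  rewrite (edom_EFin Reg_gtNy (vP n).1) lte_fin.
  move: bd_lt (vP n).2; rewrite /phi; move: (n.+1%:R^-1) => en; lra.
have dp : edom Reg p by exact: le_lt_trans Reg_p (ltry _).
exists p; split=> // w dw; apply: le_trans (infP _ dw).
by move: Reg_p; rewrite (edom_EFin Reg_gtNy dp) lee_fin /phi; lra.
Unshelve. all: by end_near. Qed.

(** The same minimizer for the extended-valued functional of which the proximal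
    point is the argmin. *)
Lemma prox_exists_ge u : exists p, forall v,
  (Reg p + (a / 2 * `|p - u| ^+ 2)%:E <= Reg v + (a / 2 * `|v - u| ^+ 2)%:E)%E.
Proof.
have [p [dp min_p]] := prox_exists u; exists p => v.
have [dv|] := pselect (edom Reg v).
  rewrite (edom_EFin Reg_gtNy dp) (edom_EFin Reg_gtNy dv) -!EFinD lee_fin.
  exact: min_p.
rewrite /edom /= => /negP; rewrite ltey negbK => /eqP ->.
by rewrite addye ?leey.
Qed.

Lemma prox_min u : edom Reg (prox a Reg u) /\
  forall v, edom Reg v -> phi u (prox a Reg u) <= phi u v.
Proof.
have := getPex (prox_exists_ge u); rewrite -/(argmin _) -/(prox a Reg u).
move: (prox a Reg u) => p /= min_p.
have dp : edom Reg p.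
  have [x0 dx0] := Reg_proper.1.
  have := min_p x0; rewrite (edom_EFin Reg_gtNy dx0) -EFinD.
  move=> /le_lt_trans/(_ (ltry _)).
  by rewrite /edom /= !ltey; apply: contra => /eqP ->; rewrite addye.
split=> // v dv; have := min_p v.
by rewrite (edom_EFin Reg_gtNy dp) (edom_EFin Reg_gtNy dv) -!EFinD lee_fin.
Qed.

(** The optimality condition a (u - p) in the subdifferential of Reg at p,
    p = prox u: compare p with the points p + t (w - p) and let t tend to 0. *)
Lemma prox_variational u w : edom Reg w ->
  r (prox a Reg u) + a * dot (u - prox a Reg u) (w - prox a Reg u) <= r w.
Proof.
have [] := prox_min u; move: (prox a Reg u) => p dp min_p dw.
rewrite -subr_le0.
apply: (@le0_of_le_small _ _ (a / 2 * `|w - p| ^+ 2)) => t t01.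
have [dz le_rz] := real_part_convex dw dp t01.
have := min_p _ dz; rewrite /phi.
have -> : p + t *: (w - p) - u = (p - u) + t *: (w - p) by rewrite addrAC.
rewrite (normsqD hdot (p - u)) normrZ exprMn dotZr real_normK ?num_real//.
have -> : dot (p - u) (w - p) = - dot (u - p) (w - p).
  by rewrite -dotNl opprB.
have [t_gt0 t_lt1] := andP t01.
move: (dot _ _) (`|w - p| ^+ 2) (`|p - u| ^+ 2) => D W P le_phi.
rewrite -(ler_pM2l t_gt0).
by move: le_phi le_rz; set rz := r _; lra.
Qed.

End Prox.

End Convex.

(** * Gradients and linear models *)

Lemma is_derive_quadratic {R : realType} (A B t : R) :
  is_derive t 1 (fun t : R => A * t + B * t ^+ 2) (A + 2 * B * t).
Proof.
by apply: is_derive_eq; rewrite /GRing.scale /=; ring.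
Qed.

Section Gradient.
Context {R : realType} {H : completeNormedModType R}.
Variable dot : {dot H for idfun}.
Hypothesis hdot : induces_norm dot.

(** The representative is the proximal point at 0 of the functional - l: the
    variational inequality for a linear functional, tested at g + h and g - h,
    is an equality. *)
Lemma riesz (l : {linear H -> R}) : continuous l ->
  exists g, forall h, l h = dot g h.
Proof.
move=> l_cts; pose Reg (v : H) := (- l v)%:E.
have Reg_proper : proper_fun Reg.
  by split=> [|u]; [exists 0; rewrite /edom /= ltry|rewrite ltNyr].
have Reg_convex : econvex_fun Reg.
  move=> u v t _; rewrite -!EFinM -EFinD lee_fin linearD !linearZ /=.
  by rewrite opprD !mulrN.
have Reg_lsc : lower_semicontinuous Reg.
  move=> x c; rewrite lte_fin => c_lt; exists [set y | c < - l y] => [|y].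
    exact: cvgr_gt (cvgN (l_cts x)) _ c_lt.
  by rewrite lte_fin.
pose g := prox 1 Reg 0.
have le_l w : l (w - g) <= dot g (w - g).
  have := prox_variational Reg_proper Reg_convex Reg_lsc hdot ltr01 0 (w := w).
  rewrite /edom /= ltry => /(_ isT); rewrite -/g /real_part /= mul1r sub0r.
  by rewrite dotNl linearB /=; lra.
exists g => h; apply/eqP; rewrite eq_le.
have := le_l (g + h); have := le_l (g - h).
by rewrite ![_ + h - _]addrAC ![_ - h - _]addrAC subrr !add0r dotNr linearN /=
  lerN2 => -> ->.
Qed.

Variable F : H -> \bar R.
Local Notation f := (real_part F).
Local Notation grad := (gradient dot F).

Lemma gradientP u : differentiable f u -> forall h, 'd f u h = dot (grad u) h.
Proof.
move=> df; apply: (getPex (P := [set g | forall h, 'd f u h = dot g h])).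
exact/riesz/diff_continuous.
Qed.

(** One-sided form of Frechet differentiability on an explicit ball. *)
Lemma first_order_bound u (e : R) : differentiable f u -> 0 < e ->
  exists2 d : R, 0 < d & forall v, `|v - u| < d ->
    f v - f u - dot (grad u) (v - u) <= e * `|v - u|.
Proof.
move=> df e_gt0.
have /eqaddoP/(_ _ e_gt0)/nbhs_ballP[d /= d_gt0 small] := diff_locally df.
exists d => // v vd.
have : ball (0 : H) d (v - u) by rewrite -ball_normE /= sub0r normrN.
move=> /small /=.
have -> : (f \o +%R^~ u - (cst (f u) + 'd f u)) (v - u) =
    f v - f u - dot (grad u) (v - u).
  rewrite -[LHS]/(f (v - u + u) - (f u + 'd f u (v - u))).
  by rewrite subrK gradientP// opprD addrA.
exact: le_trans (ler_norm _).
Qed.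

Lemma lipschitz_gradient (L : R) : L.-lipschitz grad ->
  forall u v, `|grad v - grad u| <= L * `|v - u|.
Proof. by move=> lip u v; apply: (lip (v, u)). Qed.

Lemma is_derive_line u h (t : R) : differentiable f (u + t *: h) ->
  is_derive t 1 (fun t => f (u + t *: h)) (dot (grad (u + t *: h)) h).
Proof.
move=> df; rewrite -(gradientP df) -(deriveE _ df).
have quotE : (fun e : R => e^-1 *: ((fun t => f (u + t *: h)) (e *: 1 + t)
      - f (u + t *: h))) =
    (fun e : R => e^-1 *: (f (e *: h + (u + t *: h)) - f (u + t *: h))).
  apply/funext => e /=; congr (_ *: (f _ - _)).
  by rewrite [e *: 1]mulr1 scalerDl addrCA.
have dfh : derivable f (u + t *: h) h by exact: diff_derivable.
by split; rewrite /derivable /derive /shift /= quotE.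
Qed.

Lemma descent_lemma (L : R) : (forall u, differentiable f u) ->
  L.-lipschitz grad ->
  forall u v, f v - f u - dot (grad u) (v - u) <= L / 2 * `|v - u| ^+ 2.
Proof.
move=> df lip u v.
suff desc h : f (u + h) - f u - dot (grad u) h <= L / 2 * `|h| ^+ 2.
  by have := desc (v - u); rewrite [u + _]addrC subrK.
pose A := dot (grad u) h; pose B := L / 2 * `|h| ^+ 2.
pose psi (t : R) := f (u + t *: h) : R.
pose quad : R -> R := fun t => A * t + B * t ^+ 2.
(* The mean value theorem is applied to F along the segment minus the quadratic
   upper bound: subtracting B t^2, rather than bounding the slope of psi, is
   what gives the factor 1/2. *)
pose chi : R -> R := psi - quad.
have dquad (t : R) : is_derive t 1 quad (A + L * t * `|h| ^+ 2).
  have -> : L * t * `|h| ^+ 2 = 2 * B * t by rewrite /B; move: `|h| => n; field.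
  exact: is_derive_quadratic.
have dchi (t : R) : is_derive t 1 chi
    (dot (grad (u + t *: h)) h - (A + L * t * `|h| ^+ 2)).
  have dpsi : is_derive t 1 psi (dot (grad (u + t *: h)) h).
    exact: is_derive_line.
  exact: is_deriveB.
have [|c c01] := @MVT _ chi _ 0 1 ltr01 (fun t _ => dchi t).
  by apply: derivable_within_continuous => t _; exact: ex_derive.
rewrite subr0 mulr1 => chiE.
have : chi 1 - chi 0 <= 0.
  rewrite chiE subr_le0 -lerBlDl /A -dotNl -dotDl.
  apply: (le_trans (cauchy_schwarz hdot _ _)).
  have /andP[c_gt0 _] : 0 < c < 1 by move: c01; rewrite in_itv.
  rewrite expr2 [leRHS]mulrA ler_wpM2r// -mulrA.
  apply: (le_trans (lipschitz_gradient lip _ _)).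
  by rewrite [u + _]addrC addrK normrZ gtr0_norm.
have -> : chi 1 - chi 0 = f (u + h) - f u - A - B.
  rewrite -[chi 1]/(psi 1 - (A * 1 + B * 1 ^+ 2)).
  rewrite -[chi 0]/(psi 0 - (A * 0 + B * 0 ^+ 2)).
  rewrite /psi scale1r scale0r addr0.
  by move: (f _) (f _) => a b; ring.
by rewrite subr_le0.
Qed.

End Gradient.

(** * The gradient mapping *)

Section GradientMapping.
Context {R : realType} {H : completeNormedModType R}.
Variable dot : {dot H for idfun}.
Hypothesis hdot : induces_norm dot.
Variables F Reg : H -> \bar R.
Hypotheses (Reg_proper : proper_fun Reg) (Reg_convex : econvex_fun Reg)
  (Reg_lsc : lower_semicontinuous Reg).
Local Notation f := (real_part F).
Local Notation r := (real_part Reg).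
Local Notation grad := (gradient dot F).
Local Notation T := (prox_grad dot F Reg).
Local Notation G := (gradient_mapping dot F Reg).
Implicit Types (a b : R) (x v w : H).

Lemma edom_prox_grad a x : 0 < a -> edom Reg (T a x).
Proof.
by move=> a_gt0; apply: (prox_min Reg_proper Reg_convex Reg_lsc hdot a_gt0 _).1.
Qed.

(** The optimality condition of the proximal step, in which the gradient step
    has been expanded. *)
Lemma prox_grad_variational a x w : 0 < a -> edom Reg w ->
  r (T a x) + dot (a *: (x - T a x) - grad x) (w - T a x) <= r w.
Proof.
move=> a_gt0 dw.
have := prox_variational Reg_proper Reg_convex Reg_lsc hdot a_gt0
  (x - a^-1 *: grad x) dw.
rewrite -/(T a x) -dotZl addrAC [a *: (_ - _ - _)]scalerBr scalerA.
by rewrite divff ?gt_eqF// scale1r.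
Qed.

Lemma norm_gradient_mapping a x : 0 < a -> `|G a x| = a * `|x - T a x|.
Proof. by move=> a_gt0; rewrite normrZ gtr0_norm. Qed.

Lemma prox_grad_decrease a x : 0 < a -> edom Reg x ->
  r (T a x) + a * `|x - T a x| ^+ 2 + dot (grad x) (T a x - x) <= r x.
Proof.
move=> a_gt0 dx; have := prox_grad_variational x a_gt0 dx.
rewrite -(opprB x (T a x)) dotNr dotDl dotZl dotNl hdot.
by lra.
Qed.

(** With P = G_a(x) and Q = G_b(x), monotonicity of the subdifferential of Reg
    reads (P - Q, P / a - Q / b) <= 0; together with the Cauchy-Schwarz
    inequality, (|P| - |Q|) (|P| / a - |Q| / b) <= 0, and |P| > |Q| would make
    both factors positive. *)
Lemma gradient_mapping_nondecreasing a b x : 0 < a -> a <= b ->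
  `|G a x| <= `|G b x|.
Proof.
move=> a_gt0 ab; have b_gt0 : 0 < b by exact: lt_le_trans ab.
have := prox_grad_variational x a_gt0 (edom_prox_grad x b_gt0).
have := prox_grad_variational x b_gt0 (edom_prox_grad x a_gt0).
set p := T a x; set q := T b x => var_b var_a.
have {var_a var_b} mono :
    dot (G a x - G b x) (a^-1 *: G a x - b^-1 *: G b x) <= 0.
  rewrite /gradient_mapping !scalerA !mulVf ?gt_eqF// !scale1r -/p -/q.
  have -> : x - p - (x - q) = q - p by rewrite opprB addrC subrKA.
  move: var_a var_b; rewrite -(opprB q p) dotNr -/(G _ _).
  by rewrite !dotDl !dotNl; lra.
move: (G a x) (G b x) mono => P' Q'.
have := cauchy_schwarz hdot P' Q'.
have := normr_ge0 P'; have := normr_ge0 Q'.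
rewrite !dotE (dotC dot Q' P') !hdot.
move: `|P'| `|Q'| (dot _ _) => P Q D Q_ge0 P_ge0 cs mono.
rewrite leNgt; apply/negP => QP.
have bVa : b^-1 <= a^-1 by rewrite lef_pV2.
have bV_gt0 : 0 < b^-1 by rewrite invr_gt0.
have aV_gt0 : 0 < a^-1 by rewrite invr_gt0.
have : 0 < (P - Q) * (a^-1 * P - b^-1 * Q).
  rewrite mulr_gt0 ?subr_gt0//.
  apply: (@le_lt_trans _ _ (a^-1 * Q)); first by rewrite ler_wpM2r.
  by rewrite ltr_pM2l.
have : (a^-1 + b^-1) * D <= (a^-1 + b^-1) * (P * Q).
  by rewrite ler_wpM2l// addr_ge0 ?ltW.
by lra.
Qed.

(** The subgradients of Reg at v = T_a(x) and w = T_b(v) given by the two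
    proximal steps are a (x - v) - grad x and b (v - w) - grad v; monotonicity
    leaves b |v - w|^2 <= (a (x - v) + grad v - grad x, v - w), in which the new
    step-size b occurs on the left only. *)
Lemma gradient_mapping_next a b (L : R) x : 0 < a -> 0 < b -> 0 < L ->
  `|grad (T a x) - grad x| <= L * `|T a x - x| ->
  `|G b (T a x)| <= (a + L) / a * `|G a x|.
Proof.
move=> a_gt0 b_gt0 L_gt0 lip.
rewrite [leLHS]norm_gradient_mapping// [X in _ <= _ * X]norm_gradient_mapping//.
have := prox_grad_variational x a_gt0 (edom_prox_grad (T a x) b_gt0).
have := prox_grad_variational (T a x) b_gt0 (edom_prox_grad x a_gt0).
move: (T a x) lip => v lip; move: (T b v) => w var_b var_a.
have le_sq : b * `|v - w| ^+ 2 <= ((a + L) * `|x - v|) * `|v - w|.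
  apply: (@le_trans _ _ (dot (a *: (x - v) + (grad v - grad x)) (v - w))).
    move: var_a var_b.
    move: (grad v) (grad x) (r v) (r w) => gv gx rv rw.
    have -> : w - v = - (v - w) by rewrite opprB.
    move: (v - w) (x - v) => y z; rewrite -hdot.
    by rewrite dotNr !dotDl !dotNl !dotZl; lra.
  apply: le_trans (cauchy_schwarz hdot _ _) _.
  rewrite ler_wpM2r//; apply: le_trans (ler_normD _ _) _.
  by rewrite normrZ gtr0_norm// mulrDl lerD2l (distrC x v).
rewrite mulrA divfK ?gt_eqF//.
have [->|vw0] := eqVneq `|v - w| 0.
  by rewrite mulr0 mulr_ge0// addr_ge0 ?ltW.
by rewrite -(@ler_pM2r _ `|v - w|) ?lt_neqAle ?normr_ge0 1?eq_sym ?vw0// -mulrA.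
Qed.

End GradientMapping.

(** * Large steps satisfy the nonmonotone rule *)

Section Linesearch.
Context {R : realType} {H : completeNormedModType R}.
Variable dot : {dot H for idfun}.
Hypothesis hdot : induces_norm dot.
Variables F Reg : H -> \bar R.
Hypotheses (Reg_proper : proper_fun Reg) (Reg_convex : econvex_fun Reg)
  (Reg_lsc : lower_semicontinuous Reg).
Hypotheses (F_gtNy : forall u, (-oo < F u)%E)
  (F_diff : forall u, (edom F)° u -> differentiable (real_part F) u)
  (dom_sub : edom Reg `<=` (edom F)°).
Variable delta : R.
Hypothesis delta_lt1 : delta < 1.
Local Notation f := (real_part F).
Local Notation r := (real_part Reg).
Local Notation grad := (gradient dot F).
Local Notation T := (prox_grad dot F Reg).
Local Notation G := (gradient_mapping dot F Reg).
Implicit Types (a b : R) (x v w : H).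

Lemma objective_EFin x : edom Reg x -> objective F Reg x = (f x + r x)%:E.
Proof.
move=> dx; rewrite /objective (edom_EFin Reg_proper.2 dx) EFinD.
by rewrite (edom_EFin F_gtNy)//; exact: interior_subset (dom_sub dx).
Qed.

(** The maximum over the memory is at least the current value (index j = 0), so
    the monotone decrease is enough; outside the domain of Reg the current value
    is +oo, and so is the right-hand side of the rule. *)
Lemma nonmonotone_rule_of_model_error mmax k (u : nat -> H) a : 0 < a ->
  (edom Reg (u k) ->
     f (T a (u k)) - f (u k) - dot (grad (u k)) (T a (u k) - u k)
       <= (1 - delta) * a * `|u k - T a (u k)| ^+ 2) ->
  nonmonotone_rule dot F Reg delta mmax u k a.
Proof.
move=> a_gt0 model; rewrite /nonmonotone_rule.
set c := delta / a * _ ^+ 2.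
apply: (@le_trans _ _ (objective F Reg (u k) - c%:E)%E); last first.
  apply: leeB => //; rewrite -[X in objective _ _ (u X)](subn0 k).
  exact: (le_bigmax _ (fun j : 'I__ => objective F Reg (u (k - j)%N)) ord0).
have [dx|] := pselect (edom Reg (u k)); last first.
  rewrite /edom /= => /negP; rewrite ltey negbK => /eqP Reg_y.
  by rewrite /objective Reg_y addey ?gt_eqF// addye// leey.
have dp := edom_prox_grad hdot F Reg_proper Reg_convex Reg_lsc (u k) a_gt0.
have := prox_grad_decrease hdot F Reg_proper Reg_convex Reg_lsc a_gt0 dx.
rewrite (objective_EFin dp) (objective_EFin dx) -EFinB lee_fin.
have -> : c = delta * a * `|u k - T a (u k)| ^+ 2.
  by rewrite /c norm_gradient_mapping// exprMn; field; rewrite gt_eqF.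
move: (model dx); move: (T a (u k)) => p; lra.
Qed.

(** By the affine minorant, the decrease inequality reads
    a s^2 <= K + M s for s = |x - T_a(x)|; if s >= d, this gives
    a d <= a s <= K / d + M, which fails for large a. *)
Lemma prox_grad_near x (d : R) : edom Reg x -> 0 < d ->
  exists2 A : R, 0 < A & forall a, A < a -> `|x - T a x| < d.
Proof.
move=> dx d_gt0.
have [c [b [b_ge0 minor]]] := affine_minorant Reg_proper Reg_convex Reg_lsc.
pose M := b + `|grad x|.
pose K := `|r x - c + b * `|x| |.
have M_ge0 : 0 <= M by rewrite addr_ge0.
have K_ge0 : 0 <= K by exact: normr_ge0.
have d_ge0 : 0 <= d by exact: ltW.
have A_gt0 : 0 < (K / d + M) / d + 1.
  by rewrite ltr_wpDl// divr_ge0// addr_ge0// divr_ge0.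
exists ((K / d + M) / d + 1) => //.
move=> a lt_a; rewrite ltNge; apply/negP => le_d.
have a_gt0 : 0 < a by exact: lt_trans lt_a.
have := prox_grad_decrease hdot F Reg_proper Reg_convex Reg_lsc a_gt0 dx.
have := minor _ (edom_prox_grad hdot F Reg_proper Reg_convex Reg_lsc x a_gt0).
move: (T a x) le_d => p le_d le_rp dec.
have le_p : b * `|p| <= b * (`|x - p| + `|x|).
  by rewrite ler_wpM2l// -[X in `|X| <= _](subrK x p) (distrC x) ler_normD.
have cs : - dot (grad x) (p - x) <= `|grad x| * `|x - p|.
  by rewrite -dotNr opprB cauchy_schwarz.
have leK : r x - c + b * `|x| <= K by exact: ler_norm.
have s_gt0 : 0 < `|x - p| by exact: lt_le_trans le_d.
have main : a * `|x - p| ^+ 2 <= K + M * `|x - p|.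
  by rewrite /M; move: dec le_rp le_p cs leK; rewrite -/K; lra.
have : K <= K / d * `|x - p|.
  by rewrite -[leLHS](divfK (lt0r_neq0 d_gt0)) ler_wpM2l// divr_ge0// ltW.
move=> leKd.
have : a * `|x - p| <= K / d + M.
  rewrite -(ler_pM2r s_gt0) -mulrA -expr2 mulrDl.
  by apply: le_trans main _; rewrite lerD2r.
apply/negP; rewrite -ltNge.
apply: (@lt_le_trans _ _ (a * d)); last by rewrite ler_wpM2l// ltW.
by rewrite -ltr_pdivrMr//; apply: lt_trans lt_a; rewrite ltrDl.
Qed.

(** Since a |x - T_a(x)| is bounded below by |G_b(x)| > 0 for a >= b, the error
    (1 - delta) |G_b(x)| |x - T_a(x)| of the linear model at x is dominated by
    the quadratic decrease (1 - delta) a |x - T_a(x)|^2. *)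
Lemma nonmonotone_rule_large_step x : (edom F)° x ->
  exists2 alow : R, 0 < alow & forall mmax k (u : nat -> H) a, u k = x ->
    alow <= a -> nonmonotone_rule dot F Reg delta mmax u k a.
Proof.
move=> Fx.
have [dx|ndx] := pselect (edom Reg x); last first.
  exists 1 => // mmax k u a ukx a_ge1.
  apply: nonmonotone_rule_of_model_error; first exact: lt_le_trans a_ge1.
  by rewrite ukx.
have [[b [b_gt0 Gb]]|stationary] := pselect (exists b, 0 < b /\ G b x != 0);
    last first.
  exists 1 => // mmax k u a ukx a_ge1.
  have a_gt0 : 0 < a by exact: lt_le_trans a_ge1.
  apply: nonmonotone_rule_of_model_error => // _; rewrite ukx.
  have Ga0 : G a x = 0.
    by apply/eqP/negPn/negP => Ga; apply: stationary; exists a.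
  have /eqP : `|G a x| = 0 by rewrite Ga0 normr0.
  rewrite norm_gradient_mapping// mulf_eq0 gt_eqF//= normr_eq0 subr_eq0.
  by move=> /eqP <-; rewrite !subrr linear0 normr0 expr0n /= mulr0 subrr.
have e_gt0 : 0 < (1 - delta) * `|G b x|.
  by rewrite mulr_gt0 ?normr_gt0// subr_gt0.
have [d d_gt0 first_order] := first_order_bound hdot (F_diff Fx) e_gt0.
have [A A_gt0 near_x] := prox_grad_near dx d_gt0.
exists (b + A + 1); first by rewrite !addr_gt0.
move=> mmax k u a ukx le_a.
have a_gt0 : 0 < a by apply: lt_le_trans le_a; rewrite !addr_gt0.
apply: nonmonotone_rule_of_model_error => // _; rewrite ukx.
have le_ba : b <= a.
  by apply: le_trans le_a; rewrite -addrA lerDl addr_ge0// ltW.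
have := gradient_mapping_nondecreasing hdot F Reg_proper Reg_convex Reg_lsc
  x b_gt0 le_ba.
rewrite [leRHS]norm_gradient_mapping// => le_G.
have lt_d : `|T a x - x| < d.
  by rewrite distrC; apply: near_x; apply: lt_le_trans le_a; lra.
apply: le_trans (first_order _ lt_d) _.
rewrite distrC expr2 [leRHS]mulrA ler_wpM2r// -mulrA ler_wpM2l//.
by rewrite subr_ge0 ltW.
Qed.

Lemma nonmonotone_rule_lipschitz (L : R) mmax k (u : nat -> H) a : 0 < L ->
  (edom F)° = setT -> L.-lipschitz grad ->
  L / (2 * (1 - delta)) <= a -> nonmonotone_rule dot F Reg delta mmax u k a.
Proof.
move=> L_gt0 FT lip; have delta'_gt0 : 0 < 1 - delta by rewrite subr_gt0.
have d2 : 0 < 2 * (1 - delta) by rewrite mulr_gt0.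
move=> le_a; have a_gt0 : 0 < a by apply: lt_le_trans le_a; rewrite divr_gt0.
apply: nonmonotone_rule_of_model_error => // _.
have diffF v : differentiable f v by apply: F_diff; rewrite FT.
apply: le_trans (descent_lemma hdot diffF lip _ _) _.
rewrite distrC ler_wpM2r ?sqr_ge0//.
by move: le_a; rewrite ler_pdivrMr//; lra.
Qed.

End Linesearch.

(** * Bounds on the accepted step-sizes *)

Section StepSizes.
Context {R : realType} {H : completeNormedModType R}.
Variables (dot : {dot H for idfun}) (F Reg : H -> \bar R).
Variables (delta : R) (mmax : nat) (eta ainf asup : R).
Hypotheses (eta_gt1 : 1 < eta) (ainf_gt0 : 0 < ainf)
  (ainf_lt_asup : ainf < asup).

Lemma initial_step_ge aBB : ainf <= initial_step ainf asup aBB.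
Proof. by rewrite /initial_step le_max lexx. Qed.

Lemma initial_step_le aBB : initial_step ainf asup aBB <= asup.
Proof. by rewrite /initial_step ge_max (ltW ainf_lt_asup) ge_min lexx. Qed.

Lemma linesearch_terminates (u : nat -> H) k (alow : R) :
  (forall a, alow <= a -> nonmonotone_rule dot F Reg delta mmax u k a) ->
  linesearch_well_defined dot F Reg delta mmax eta ainf asup u k alow.
Proof.
move=> rule; split=> // aBB; set aint := initial_step _ _ _.
have aint_gt0 : 0 < aint by exact: lt_le_trans (initial_step_ge _).
have ex_i : exists i,
    `[< nonmonotone_rule dot F Reg delta mmax u k (aint * eta ^+ i) >].
  have eta_gt0 : 0 < eta by exact: lt_trans eta_gt1.
  have etaV_lt1 : `|eta^-1| < 1.
    by rewrite gtr0_norm ?invr_gt0// invf_lt1.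
  near \oo => i; exists i; apply/asboolP/rule.
  rewrite -ler_pdivrMr ?exprn_gt0// -exprVn ltW//; near: i.
  exact: cvgr_lt (cvg_geometric alow etaV_lt1) _ aint_gt0.
exists (ex_minn ex_i); case: ex_minnP => i /asboolP rule_i min_i; split=> //.
by move=> i' rule_i'; apply: min_i; apply/asboolP.
Unshelve. all: by end_near. Qed.

Lemma step_size_ge aBB (i : nat) :
  ainf <= initial_step ainf asup aBB * eta ^+ i.
Proof.
apply: le_trans (initial_step_ge aBB) _.
rewrite ler_peMr ?exprn_ege1 ?ltW//.
exact: lt_le_trans (initial_step_ge _).
Qed.

(** If i > 0, the trial with exponent i - 1 was rejected, hence lies below
    alow. *)
Lemma step_size_le (u : nat -> H) k (alow aBB : R) (i : nat) :
  (forall a, alow <= a -> nonmonotone_rule dot F Reg delta mmax u k a) ->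
  linesearch_index dot F Reg delta mmax eta u k
    (initial_step ainf asup aBB) i ->
  initial_step ainf asup aBB * eta ^+ i <= Num.max (eta * alow) asup.
Proof.
move=> rule [_ min_i]; rewrite le_max.
case: i min_i => [|i] min_i; first by rewrite mulr1 initial_step_le orbT.
apply/orP; left; rewrite exprS mulrCA ler_pM2l; last exact: lt_trans eta_gt1.
rewrite leNgt; apply/negP => /ltW/rule/min_i.
by rewrite ltnn.
Qed.

End StepSizes.

Theorem lemma3 (R : realType) (H : completeNormedModType R)
    (dot : {dot H for idfun}) (hdot : induces_norm dot)
    (F Reg : H -> \bar R)
    (Reg_proper : proper_fun Reg) (Reg_convex : econvex_fun Reg)
    (Reg_lsc : lower_semicontinuous Reg)
    (F_gtNy : forall u, (-oo < F u)%E)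
    (F_C1 : continuously_differentiable F (edom F)°)
    (dom_sub : edom Reg `<=` (edom F)°)
    (delta : R) (delta_gt0 : 0 < delta) (delta_lt1 : delta < 1)
    (mmax : nat) (eta : R) (eta_gt1 : 1 < eta)
    (ainf asup : R) (ainf_gt0 : 0 < ainf) (ainf_lt_asup : ainf < asup)
    (u0 : H) (a0 : R) (a0_gt0 : 0 < a0) :
  (delta < 1 / 2 ->
     forall x : H, (edom F)° x ->
     exists alow : R, 0 < alow /\
       forall (k : nat) (u : nat -> H), u k = x ->
         linesearch_well_defined dot F Reg delta mmax eta ainf asup u k alow)
  /\
  (forall L : R, 0 < L ->
     (edom F)° = setT -> L.-lipschitz (gradient dot F) ->
     [/\ forall (k : nat) (u : nat -> H), (edom F)° (u k) ->
           linesearch_well_defined dot F Reg delta mmax eta ainf asup u k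
             (L / (2 * (1 - delta))),
         forall (k : nat) (u : nat -> H) (alpha : nat -> R), (1 <= k)%N ->
           splitting_run dot F Reg delta mmax eta ainf asup u0 a0 k.+1 u alpha ->
           alpha k <= Num.max (eta * L / (2 * (1 - delta))) asup
       & forall (k : nat) (u : nat -> H) (alpha : nat -> R),
           splitting_run dot F Reg delta mmax eta ainf asup u0 a0 k.+2 u alpha ->
           let abar := Num.max (eta * L / (2 * (1 - delta))) asup in
           let C_G := (3 * abar + L) / ainf in
           `|gradient_mapping dot F Reg (alpha k.+1) (u k.+1)|
             <= C_G * `|gradient_mapping dot F Reg (alpha k) (u k)|]).
Proof.
have F_diff u : (edom F)° u -> differentiable (real_part F) u.
  by move=> /F_C1[].
split=> [_ x Fx|L L_gt0 FT lip].
  have [alow alow_gt0 rule] := nonmonotone_rule_large_step hdot Reg_proper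
    Reg_convex Reg_lsc F_gtNy F_diff dom_sub delta_lt1 Fx.
  exists alow; split=> // k u ukx; apply: linesearch_terminates => // a.
  exact: rule.
have rule (u : nat -> H) k a : L / (2 * (1 - delta)) <= a ->
    nonmonotone_rule dot F Reg delta mmax u k a.
  exact: nonmonotone_rule_lipschitz.
have upper (u : nat -> H) (alpha : nat -> R) n k : (k < n)%N ->
    splitting_run dot F Reg delta mmax eta ainf asup u0 a0 n u alpha ->
    alpha k <= Num.max (eta * L / (2 * (1 - delta))) asup.
  move=> kn [_ /(_ k kn)[aBB [i [_ index_i -> _ _]]]].
  by rewrite -mulrA; exact: step_size_le (rule u k) index_i.
split.
- by move=> k u _; apply: linesearch_terminates => // a; exact: rule.
- by move=> k u alpha _; exact: upper.
move=> k u alpha run /=; set abar := Num.max _ _; set C_G := _ / ainf.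
have le_abar : alpha k <= abar by apply: upper run; rewrite ltnS leqnSn.
have ge_ainf j : (j < k.+2)%N -> ainf <= alpha j.
  move=> jk; have [_ /(_ j jk)[aBB [i [_ _ -> _ _]]]] := run.
  exact: step_size_ge.
have uS : u k.+1 = prox_grad dot F Reg (alpha k) (u k).
  by have [_ /(_ k)] := run; rewrite ltnS leqnSn => /(_ isT)[aBB [i []]].
have ak_ge : ainf <= alpha k by apply: ge_ainf; rewrite ltnS leqnSn.
have ak_gt0 : 0 < alpha k by exact: lt_le_trans ak_ge.
have ak1_gt0 : 0 < alpha k.+1 by apply: lt_le_trans (ge_ainf _ _).
rewrite uS; apply: le_trans (gradient_mapping_next hdot Reg_proper Reg_convex
  Reg_lsc ak_gt0 ak1_gt0 L_gt0 (lipschitz_gradient lip _ _)) _.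
rewrite ler_wpM2r//; apply: ler_pM.
- by rewrite addr_ge0 ?ltW.
- by rewrite invr_ge0 ltW.
- by rewrite lerD2r; move: ak_gt0 le_abar; lra.
- by rewrite lef_pV2.
Qed.
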